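(* Let $m>1$ and $n>1$ be integers such that the numbers $k(k-1)$ for $k=1,\ldots,n$ are pairwise distinct modulo $m$. (i) Then $m\geqslant 2n-1$. (ii) If $n\geqslant 15$ and $m\leqslant 2.4n$, then $m$ is a prime or a power of two. *)

(* Defs.v *)
From mathcomp Require Export all_boot all_order all_algebra.

(* The truncated subtraction of nat is exact here, since j, k >= 1. *)
Definition distinct_mod (m n : nat) : Prop :=
  forall j k : nat, 1 <= j <= n -> 1 <= k <= n -> j != k ->
    j * (j - 1) != k * (k - 1) %[mod m].

(* Main.v *)
Require Import Defs.
From mathcomp Require Import zify.
Import GRing.Theory Num.Theory.

(** Since k(k-1) - j(j-1) = (k-j)(k+j-1), the hypothesis says that m divides no
    product a * b of positive integers of opposite parity with a + b < 2n.
    If m < 2n-1, then (1, m) or (2, m) is a forbidden pair. If m is neither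
    prime nor a power of two, then either m is even and the pair (2^s, q),
    where m = 2^s * q with q odd, is forbidden, or m = p * q with p <= q odd
    and the pair (2p, q) is. *)

Lemma distinct_mod_ndvd_mul (m n a b : nat) :
  distinct_mod m n -> 0 < a -> 0 < b -> odd (a + b) -> a + b < 2 * n ->
  ~~ (m %| a * b).
Proof.
wlog lt_ab : a b / a < b => [hwlog hmn a0 b0 odd_ab lt_n | hmn a0 b0 odd_ab lt_n].
  case: (ltngtP a b) => [lt_ab | lt_ba | eq_ab]; first exact: hwlog.
    by rewrite mulnC; apply: hwlog => //; rewrite addnC.
  by move: odd_ab; rewrite eq_ab addnn odd_double.
(* The indices [j = i + 1] and [k = i + 1 + a] solve [k - j = a], [k + j - 1 = b]; then
   [a + b < 2 * n] amounts to [k <= n]. *)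
have [i Eb] : exists i, b = a + 2 * i + 1 by exists ((b - a) %/ 2); lia.
have := hmn i.+1 (i.+1 + a) ltac:(lia) ltac:(lia) ltac:(lia).
apply: contraNN => dvd_ab.
have -> : (i.+1 + a) * (i.+1 + a - 1) = a * b + i.+1 * (i.+1 - 1).
  by rewrite addSn !subn1 /= Eb; lia.
by rewrite -[X in _ == X]modnDml (eqP dvd_ab) add0n.
Qed.

Lemma distinct_mod_lower_bound (m n : nat) :
  1 < m -> distinct_mod m n -> 2 * n - 1 <= m.
Proof.
move=> hm hmn; rewrite leqNgt; apply/negP => lt_m.
(* The cofactor 2 or 1 makes the sum odd. For odd [m], parity sharpens [m < 2 * n - 1] to
   [m + 2 < 2 * n]. *)
have [odd_m | even_m] := boolP (odd m).
  by have := @distinct_mod_ndvd_mul m n 2 m hmn; rewrite dvdn_mull //; lia.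
by have := @distinct_mod_ndvd_mul m n 1 m hmn; rewrite dvdn_mull //; lia.
Qed.

Lemma distinct_mod_prime_or_pow2 (m n : nat) :
  1 < m -> distinct_mod m n -> 6 <= n -> 5 * m <= 12 * n ->
  prime m \/ exists a : nat, m = 2 ^ a.
Proof.
move=> hm hmn hn le_m; have m0 : 0 < m by lia.
have [odd_m | even_m] := boolP (odd m).
  left; apply/negPn/negP => nprime_m.
  have [p [q [p1 [le_pq Em]]]] : exists p q, 1 < p /\ p <= q /\ m = p * q.
    exists (pdiv m), (m %/ pdiv m); rewrite mulnC divnK ?pdiv_dvd //.
    split; first by rewrite prime_gt1 ?pdiv_prime.
    split=> //; rewrite leq_divRL ?pdiv_gt0 // leqNgt.
    by apply: contra nprime_m => /ltn_pdiv2_prime ->.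
  have /andP[odd_p odd_q] : odd p && odd q by rewrite -oddM -Em.
  have := @distinct_mod_ndvd_mul m n (2 * p) q hmn.
  rewrite -mulnA -Em dvdn_mull // => ndvd.
  have : 2 * p + q < 2 * n.
    (* Here [2 * n] is at least 5/6 of [p * q]. If [5 <= p], this exceeds [3 * q], hence
       [2 * p + q]. If [p = 3], it is 5/2 of [q], which exceeds [q + 6] for [5 <= q]; [q = 3] is
       settled by [6 <= n]. *)
    have [p3 | p5] : p = 3 \/ 5 <= p by lia.
      by lia.
    by have := leq_mul p5 (leqnn q); lia.
  by lia.
right; have [q odd_q Em] := pfactor_coprime (isT : prime 2) m0.
move: odd_q; rewrite coprime2n => odd_q.
set t := logn 2 m in Em *.
have t0 : 0 < t.
  by rewrite lt0n; apply: contraNneq even_m => t0; rewrite Em t0 muln1.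
exists t; have [q1 | q3] : q = 1 \/ 3 <= q by lia.
  by rewrite Em q1 mul1n.
have u2 : 2 <= 2 ^ t by rewrite -{1}(expn1 2) leq_exp2l.
have even_u : ~~ odd (2 ^ t) by rewrite oddX; lia.
have := @distinct_mod_ndvd_mul m n q (2 ^ t) hmn; rewrite -Em dvdnn.
move: (2 ^ t) Em u2 even_u => u Em u2 even_u.
have : q + u < 2 * n.
  (* Expanding [(q - 2) * (u - 2) >= 0] gives [2 * (q + u) <= m + 4], so [q + u] is at most 6/5 of
     [n] plus 2, below [2 * n]. *)
  have [x Eq] : exists x, q = x + 2 by exists (q - 2); lia.
  have [y Eu] : exists y, u = y + 2 by exists (u - 2); lia.
  by move: Em; rewrite Eq Eu mulnDl !mulnDr; lia.
by lia.
Qed.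

Lemma natr_le_2p4_mul (m n : nat) :
  (m%:R <= 2.4%Q * n%:R :> rat)%R -> 5 * m <= 12 * n.
Proof.
have -> : (2.4%Q = 12%:R / 5%:R :> rat)%R by apply/eqP.
by rewrite mulrAC ler_pdivlMr // -!natrM ler_nat mulnC.
Qed.

Theorem theorem2p1 (m n : nat) (hm : 1 < m) (hn : 1 < n)
    (hmn : distinct_mod m n) :
  (2 * n - 1 <= m) /\
  (15 <= n -> (m%:R <= 2.4%Q * n%:R :> rat)%R ->
     prime m \/ exists a : nat, m = 2 ^ a).
Proof.
split; first exact: distinct_mod_lower_bound.
move=> n15 /natr_le_2p4_mul; apply: distinct_mod_prime_or_pow2 => //; lia.
Qed.
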